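(* Let $q=p^k$ with $p$ prime and $k\ge1$ an integer, let $s\ge 1$ be an integer and let $e_1,\ldots,e_s$ be distinct non-negative integers. Let $S_{e_1,\ldots,e_s}(q)$ denote the number of equivalence classes, under dynamical equivalence, of the dynamical systems $(\mathbb{F}_q, x\mapsto f(x))$ where $f$ ranges over all polynomials of the form $f(X)=\sum_{i=1}^s a_iX^{e_i}\in\mathbb{F}_q[X]$ with $a_1,\ldots,a_s\in\mathbb{F}_q^*$. Then $$S_{e_1,\ldots,e_s}(q)\le \frac{(q-1)^s}{k}+\frac{2(q^{1/2}-1)^{s}}{k}+(q^{1/3}-1)^{s}.$$
   Context: A dynamical system is a pair $(\mathbb{S},f)$ with $f:\mathbb{S}\to\mathbb{S}$ a map. Two dynamical systems $(\mathbb{S},f)$ and $(\mathbb{T},g)$ are dynamically equivalent if there is a bijection $\sigma:\mathbb{S}\to\mathbb{T}$ with $\sigma^{-1}\circ g\circ\sigma=f$. $\mathbb{F}_q$ is the finite field with $q$ elements and $\mathbb{F}_q^*=\mathbb{F}_q\setminus\{0\}$. *)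

(* Defs.v *)
From mathcomp Require Import all_boot all_order all_algebra.
From mathcomp Require Import boolp.

Set Implicit Arguments.
Unset Strict Implicit.
Unset Printing Implicit Defensive.

Import GRing.Theory.
Local Open Scope ring_scope.

Definition dyn_equiv (S T : Type) (f : S -> S) (g : T -> T) : Prop :=
  exists (sigma : S -> T) (sigmaV : T -> S),
    [/\ cancel sigma sigmaV, cancel sigmaV sigma &
        sigmaV \o g \o sigma =1 f].

Lemma dyn_equiv_refl (S : Type) (f : S -> S) : dyn_equiv f f.
Proof. by exists id, id. Qed.

Lemma dyn_equiv_sym (S T : Type) (f : S -> S) (g : T -> T) :
  dyn_equiv f g -> dyn_equiv g f.
Proof.
case=> sigma [sigmaV [sK sVK fg]]; exists sigmaV, sigma; split=> // y.
by rewrite /= -fg /= !sVK.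
Qed.

Lemma dyn_equiv_trans (S T U : Type) (f : S -> S) (g : T -> T) (h : U -> U) :
  dyn_equiv f g -> dyn_equiv g h -> dyn_equiv f h.
Proof.
case=> s [sV [sK sVK fg]] [t [tV [tK tVK gh]]].
exists (t \o s), (sV \o tV); split=> x /=; first by rewrite tK sK.
  by rewrite sVK tVK.
by rewrite -fg /= -gh.
Qed.

Definition sparse_poly (F : nzRingType) (s : nat) (e : 'I_s -> nat)
    (a : 'I_s -> F) : {poly F} :=
  \sum_(i < s) a i *: 'X^(e i).

Definition sparse_systems (F : finFieldType) (s : nat) (e : 'I_s -> nat) :
    {set {ffun F -> F}} :=
  [set [ffun x => (sparse_poly e a).[x]]
    | a : {ffun 'I_s -> F} & [forall i, a i != 0]].

Definition dyn_equivb (F : finType) (f g : {ffun F -> F}) : bool :=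
  `[< dyn_equiv f g >].

(* The blocks of this partition are the equivalence classes because dyn_equiv
   is an equivalence relation, by the three lemmas above. Distinct polynomials
   inducing the same map on F are the same dynamical system, so nothing is lost
   by classifying maps instead of polynomials. *)
Definition num_dyn_classes (F : finFieldType) (s : nat) (e : 'I_s -> nat) :
    nat :=
  #|equivalence_partition (@dyn_equivb F) (sparse_systems F e)|.

(* Main.v *)
(** Conjugating by the Frobenius automorphism x |-> x ^ p replaces each
    coefficient a_i of a polynomial by a_i ^ p, so the number of classes is at
    most the number of orbits of the Frobenius, which has order k, on
    coefficient vectors with nonzero entries.  By the Cauchy-Frobenius lemma
    this is the mean over i < k of the number of vectors fixed by the i-th
    power of the Frobenius, i.e. of (p ^ g - 1) ^ s with g = gcd (i, k).  Here
    g = k only for i = 0, g = k / 2 only for i = k / 2, and otherwise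
    g <= k / 3. *)
Require Import Defs.
From mathcomp Require Import all_boot all_order all_algebra.
From mathcomp Require Import reals exp.
From mathcomp Require Import boolp.
From mathcomp Require Import all_fingroup cyclic finfield zify lra.

Set Implicit Arguments.
Unset Strict Implicit.
Unset Printing Implicit Defensive.

Local Open Scope ring_scope.

Import Order.TTheory GRing.Theory Num.Theory.

(** Such an [h] factors through the orbit map: as its values are sets, [h x] is the union of [h y]
    over the orbit of [x], and no representative has to be chosen. *)
Lemma leq_card_imset_orbit (aT : finGroupType) (D : {group aT})
    (sT T : finType) (to : action D sT) (G : {group aT}) (h : sT -> {set T})
    (S : {set sT}) :
    (forall x y, y \in orbit to G x -> h y = h x) ->
  (#|h @: S| <= #|orbit to G @: S|)%N.
Proof.
move=> h_orbit.
suff -> : h @: S = (fun O : {set sT} => \bigcup_(y in O) h y) @: (orbit to G @: S).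
  exact: leq_imset_card.
rewrite -imset_comp; apply: eq_in_imset => x _ /=.
apply/eqP; rewrite eqEsubset (bigcup_sup x) ?orbit_refl //=.
by apply/bigcupsP => y /h_orbit ->.
Qed.

Lemma big_cycle (gT : finGroupType) (R : Type) (idx : R)
    (op : Monoid.com_law idx) (x : gT) (f : gT -> R) :
  \big[op/idx]_(y in <[x]>%g) f y = \big[op/idx]_(i < #[x]%g) f (x ^+ i)%g.
Proof.
have -> : <[x]>%g = [set (x ^+ nat_of_ord i)%g | i : 'I_#[x]%g].
  apply/setP => y; apply/idP/imsetP => [/cyclePmin[i i_lt ->]|[i _ ->]].
    by exists (Ordinal i_lt).
  exact: mem_cycle.
rewrite big_imset //= => i j _ _ /eqP.
by rewrite eq_expg_mod_order !modn_small // => /eqP/val_inj.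
Qed.

Lemma card_ffun_all (I T : finType) (P : pred T) :
  #|[set a : {ffun I -> T} | [forall i, P (a i)]]| = (#|P| ^ #|I|)%N.
Proof.
by rewrite -card_ffun_on cardsE.
Qed.

Section Frobenius.

Variables (p k : nat) (F : finFieldType).
Hypotheses (p_pr : prime p) (k_gt0 : (0 < k)%N) (cardF : #|F| = (p ^ k)%N).

Let pcharFp : p \in [pchar F].
Proof. exact: card_finPcharP cardF p_pr. Qed.

Lemma expf_p_inj : injective (fun x : F => x ^+ p).
Proof. exact: (fmorph_inj (pFrobenius_aut pcharFp)). Qed.

(** Both the [i]-th and the [k]-th power of the Frobenius fix [x], the latter because
    [x ^+ #|F| = x]; Bezout's relation [u * i = v * k + gcdn i k] then gives the claim. *)
Lemma expf_p_gcdn (x : F) (i : nat) :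
  x ^+ (p ^ i) = x -> x ^+ (p ^ gcdn i k) = x.
Proof.
have fix_mul m n : x ^+ (p ^ m) = x -> x ^+ (p ^ (n * m)) = x.
  by move=> xm; elim: n => [|n IHn]; rewrite ?expr1 // mulSn expnD exprM xm.
have [-> _|i_gt0 xi] := posnP i; first by rewrite gcd0n -cardF expf_card.
have [u v uv _] := egcdnP k i_gt0.
by rewrite -{2}(fix_mul i u xi) uv expnD exprM fix_mul // -cardF expf_card.
Qed.

(** A nonzero [x] with [x ^+ (p ^ g) = x] is a root of unity of order dividing [p ^ g - 1], which is
    positive since [g > 0]. *)
Lemma card_expf_p_fixed (i : nat) :
  (#|[pred x : F | (x != 0)%R && (x ^+ (p ^ i) == x)%R]| <= p ^ gcdn i k - 1)%N.
Proof.
set g := gcdn i k.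
have g_gt0 : (0 < g)%N by rewrite gcdn_gt0 k_gt0 orbT.
have pg_gt1 : (1 < p ^ g)%N by rewrite -(exp1n g) ltn_exp2r ?prime_gt1.
rewrite cardE; apply: max_unity_roots; rewrite ?enum_uniq ?subn_gt0 //.
apply/allP => x; rewrite mem_enum inE => /andP[x_neq0 /eqP/expf_p_gcdn xg].
apply/unity_rootP/(mulfI x_neq0).
by rewrite mulr1 -exprS -addn1 subnK ?xg // ltnW.
Qed.

Variable s : nat.

Definition frob_ffun (a : {ffun 'I_s -> F}) := [ffun j => a j ^+ p].

Lemma frob_ffun_inj : injective frob_ffun.
Proof.
by move=> a b /ffunP ab; apply/ffunP => j; apply: expf_p_inj; move: (ab j); rewrite !ffunE.
Qed.

Definition frob_perm : {perm {ffun 'I_s -> F}} := perm frob_ffun_inj.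

Lemma frob_permX (i : nat) (a : {ffun 'I_s -> F}) (j : 'I_s) :
  (frob_perm ^+ i)%g a j = a j ^+ (p ^ i).
Proof.
elim: i => [|i IHi]; first by rewrite expg0 perm1 expr1.
by rewrite expgSr permM permE ffunE IHi -exprM expnSr.
Qed.

Lemma order_frob_perm : (0 < s)%N -> #[frob_perm]%g = k.
Proof.
move=> s_gt0.
have dvd_k : (#[frob_perm]%g %| k)%N.
  rewrite order_dvdn; apply/eqP/permP => a; apply/ffunP => j.
  by rewrite frob_permX perm1 -cardF expf_card.
apply/eqP; rewrite eqn_leq dvdn_leq //=.
set n := #[frob_perm]%g in dvd_k *.
(* Constant vectors carry the triviality of the [n]-th power over to [F] itself; a coordinate to
   read off exists because [s > 0]. Counting fixed points then forces [k <= n]. *)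
have all_fixed (x : F) : x ^+ (p ^ n) = x.
  have := frob_permX n [ffun=> x] (Ordinal s_gt0).
  by rewrite expg_order perm1 !ffunE.
have := card_expf_p_fixed n; rewrite (gcdn_idPl dvd_k) => le_card.
have {le_card} : (#|F|.-1 <= p ^ n - 1)%N.
  rewrite -(cardC1 (0 : F)); apply: leq_trans le_card.
  by apply/subset_leq_card/subsetP => x; rewrite !inE all_fixed eqxx andbT.
rewrite cardF -subn1 leq_sub2rE ?expn_gt0 ?prime_gt0 //.
by rewrite leq_exp2l ?prime_gt1.
Qed.

Definition nz_ffun := [set a : {ffun 'I_s -> F} | [forall j, a j != 0]].

Lemma frob_perm_acts : [acts <[frob_perm]>%g, on nz_ffun | 'P].
Proof.
rewrite cycle_subG; apply/astabsP => a; rewrite /= apermE permE !inE.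
by apply: eq_forallb => j; rewrite ffunE expf_eq0 prime_gt0.
Qed.

(** A vector is fixed exactly when each of its coordinates is, so the one-coordinate bound is raised
    to the power [s]. *)
Lemma card_frob_perm_fixed (i : nat) : (0 < s)%N ->
  (#|('Fix_(nz_ffun | 'P)[frob_perm ^+ i])%g| <= (p ^ gcdn i k - 1) ^ s)%N.
Proof.
move=> s_gt0; move: card_expf_p_fixed => /(_ i); rewrite -(leq_exp2r _ _ s_gt0).
apply: leq_trans; rewrite -[X in (_ <= _ ^ X)%N]card_ord -card_ffun_all.
apply/subset_leq_card/subsetP => a; rewrite !inE sub1set inE => /andP[/forallP a_neq0].
rewrite /= apermE => /eqP a_fix; apply/forallP => j.
by rewrite /= a_neq0 -frob_permX a_fix eqxx.
Qed.

Variable e : 'I_s -> nat.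

Definition sparse_map (a : {ffun 'I_s -> F}) : {ffun F -> F} :=
  [ffun x => (sparse_poly e a).[x]].

Lemma sparse_map_frob (a : {ffun 'I_s -> F}) (x : F) :
  sparse_map (frob_perm a) (x ^+ p) = sparse_map a x ^+ p.
Proof.
rewrite !ffunE /sparse_poly !horner_sum -(pFrobenius_autE pcharFp (\sum_i _)).
rewrite rmorph_sum; apply: eq_bigr => j _.
by rewrite !hornerE permE ffunE rmorphM rmorphXn.
Qed.

Lemma dyn_equiv_frob (a : {ffun 'I_s -> F}) :
  dyn_equiv (sparse_map a) (sparse_map (frob_perm a)).
Proof.
have [root_p expK rootK] := injF_bij expf_p_inj.
by exists (fun x => x ^+ p), root_p; split=> // x /=; rewrite sparse_map_frob expK.
Qed.

Lemma dyn_equiv_frob_orbit (a b : {ffun 'I_s -> F}) :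
    b \in orbit 'P <[frob_perm]>%g a ->
  dyn_equiv (sparse_map a) (sparse_map b).
Proof.
case/orbitP => _ /cycleP[i ->] <- /=; rewrite apermE.
elim: i => [|i IHi]; first by rewrite expg0 perm1; apply: dyn_equiv_refl.
by rewrite expgSr permM; apply: dyn_equiv_trans IHi (dyn_equiv_frob _).
Qed.

Lemma num_dyn_classes_le_orbits :
  (num_dyn_classes F e <= #|orbit 'P <[frob_perm]>%g @: nz_ffun|)%N.
Proof.
rewrite /num_dyn_classes /equivalence_partition.
have -> : sparse_systems F e = sparse_map @: nz_ffun.
  by apply: eq_imset.
(* The blocks are now the images of coefficient vectors under [a] to the class of [sparse_map a],
   which is constant on orbits. *)
rewrite -imset_comp; apply: leq_card_imset_orbit => a b /dyn_equiv_frob_orbit ab.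
apply/setP => g; rewrite !inE /dyn_equivb; congr (_ && _).
apply/asboolP/asboolP; apply: dyn_equiv_trans => //.
exact: dyn_equiv_sym.
Qed.

End Frobenius.

Lemma exprn_le_powR_div (R : realType) (p k m n : nat) :
    (0 < p)%N -> (0 < m)%N -> (m * n <= k)%N ->
  (p ^ n)%:R <= (p ^ k)%:R `^ (1 / m%:R) :> R.
Proof.
move=> p_gt0 m_gt0 mn_le_k.
have -> : (p ^ n)%:R = (p ^ (n * m))%:R `^ (1 / m%:R) :> R.
  rewrite expnM [in RHS]natrX -powR_mulrn ?ler0n // -powRrM div1r divff ?powRr1 //.
  by rewrite pnatr_eq0 -lt0n.
rewrite ge0_ler_powR ?nnegrE ?ler0n ?divr_ge0 ?ler01 //.
by rewrite ler_nat leq_pexp2l // mulnC.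
Qed.

(** Write [k = c * g] and [i = d * g] with [d < c]. If [c < 3], then [d = 0], or [c = 2] and
    [d = 1]. *)
Lemma gcdn_lt_cases (i k : nat) : (i < k)%N ->
  [\/ i = 0, i.*2 = k | 3 * gcdn i k <= k]%N.
Proof.
move=> i_lt_k; have [->|i_gt0] := posnP i; first by constructor 1.
have := dvdn_gcdl i k; have := dvdn_gcdr i k.
move: (gcdn i k) => g /dvdnP[c kE] /dvdnP[d iE].
have [c_ge3|c_lt3] := leqP 3 c; first by constructor 3; rewrite kE leq_mul2r c_ge3 orbT.
subst k i; constructor 2; case: c c_lt3 d i_lt_k i_gt0 => [|[|[|]]] // _ [|[|d]] //; nia.
Qed.

(** At most one term is nonzero. There may be none: no [i] has [i.*2 = k] when [k] is odd. *)
Lemma sum_indicator_le (R : numDomainType) (I : finType) (P : pred I) (x : R) :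
    0 <= x -> {in P &, forall i j, i = j} ->
  \sum_i (P i)%:R * x <= x.
Proof.
move=> x_ge0 P_uniq; rewrite -mulr_suml -[leRHS]mul1r ler_wpM2r //.
have -> : \sum_i (P i)%:R = #|P|%:R :> R.
  rewrite -sum1_card natr_sum [RHS]big_mkcond; apply: eq_bigr => i _.
  by rewrite unfold_in; case: (P i).
by rewrite lern1; apply/card_le1_eqP => i j Pi Pj; apply: P_uniq.
Qed.

Theorem theorem3p2 (R : realType) (p k q : nat) (F : finFieldType)
    (s : nat) (e : 'I_s -> nat)
    (hp : prime p) (hk : (1 <= k)%N) (hq : q = (p ^ k)%N) (hF : #|F| = q)
    (hs : (1 <= s)%N) (he : injective e) :
  (num_dyn_classes F e)%:R <=
    (q%:R - 1) ^+ s / k%:R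
    + 2 * (q%:R `^ (1 / 2) - 1) ^+ s / k%:R
    + (q%:R `^ (1 / 3) - 1) ^+ s :> R.
Proof.
subst q; have p_gt0 := prime_gt0 hp.
set q : R := (p ^ k)%:R; set A := (q - 1) ^+ s.
set B := (q `^ (1 / 2) - 1) ^+ s; set C := (q `^ (1 / 3) - 1) ^+ s.
have root_ge1 m : (0 < m)%N -> 0 <= q `^ (1 / m%:R) - 1.
  move=> m_gt0; rewrite subr_ge0.
  (* The exponent [n = 0] turns the left side into 1. *)
  by apply: le_trans (@exprn_le_powR_div R p k m 0 p_gt0 m_gt0 _); rewrite ?muln0.
have B_ge0 : 0 <= B by apply/exprn_ge0/root_ge1.
have C_ge0 : 0 <= C by apply/exprn_ge0/root_ge1.
have A_ge0 : 0 <= A by rewrite exprn_ge0 // subr_ge0 ler1n expn_gt0 p_gt0.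
(* One bound serves all three cases, since the surplus terms are nonnegative. [C] is charged to
   every [i], so it loses its denominator after division by [k]. *)
have fixed_le (i : 'I_k) : ((p ^ gcdn i k - 1) ^ s)%:R <=
    (i == 0 :> nat)%:R * A + (i.*2 == k)%:R * B + C.
  have pow_le m : (0 < m)%N -> (m * gcdn i k <= k)%N ->
      ((p ^ gcdn i k - 1) ^ s)%:R <= (q `^ (1 / m%:R) - 1) ^+ s :> R.
    move=> m_gt0 m_le; rewrite natrX natrB ?expn_gt0 ?p_gt0 //.
    rewrite lerXn2r ?nnegrE ?root_ge1 ?subr_ge0 ?ler1n ?expn_gt0 ?p_gt0 //.
    by rewrite lerD2r exprn_le_powR_div.
  have [i0|i2|g3] := gcdn_lt_cases (ltn_ord i).
  - rewrite i0 gcd0n eqxx natrX natrB ?expn_gt0 ?p_gt0 // -/q -/A mul1r.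
    by rewrite -addrA lerDl addr_ge0 // mulr_ge0.
  - rewrite i2 eqxx mul1r -addrA addrCA; apply: (le_trans (pow_le 2%N _ _)) => //.
      by rewrite (gcdn_idPl _) ?mul2n ?i2 //; apply/dvdnP; exists 2%N; rewrite mul2n.
    by rewrite lerDl addr_ge0 // mulr_ge0.
  - apply: (le_trans (pow_le 3%N _ _)) => //.
    by rewrite lerDr addr_ge0 // mulr_ge0.
have orbits_le : (#|orbit 'P <[frob_perm hp hF s]>%g @: nz_ffun F s| * k)%N%:R
    <= A + B + C *+ k.
  rewrite -[X in (_ * X)%N](order_frob_perm hp hk hF hs) -Frobenius_Cauchy; last first.
    exact: frob_perm_acts.
  rewrite big_cycle order_frob_perm // natr_sum.
  apply: (@le_trans _ _ (\sum_(i < k)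
      ((i == 0 :> nat)%:R * A + (i.*2 == k)%:R * B + C))).
    apply: ler_sum => i _; apply: le_trans (fixed_le i).
    by rewrite ler_nat card_frob_perm_fixed.
  rewrite !big_split /= sumr_const card_ord lerD2r lerD //.
    apply: (@sum_indicator_le _ _ (fun i : 'I_k => i == 0 :> nat)) => // i j.
    by rewrite !unfold_in => /eqP i0 /eqP j0; apply: val_inj; rewrite /= i0.
  apply: (@sum_indicator_le _ _ (fun i : 'I_k => i.*2 == k)) => // i j.
  rewrite !unfold_in => /eqP ik /eqP jk; apply/val_inj/double_inj.
  by rewrite /= ik.
have k_gt0 : 0 < k%:R :> R by rewrite ltr0n.
rewrite -(ler_pM2r k_gt0) !mulrDl !divfK ?gt_eqF // -natrM.
(* The count yields [B] once; the stated [2 * B] follows from [B >= 0]. *)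
apply: (@le_trans _ _ (A + B + C *+ k)); last first.
  by rewrite mulr_natr; lra.
apply: le_trans orbits_le.
by rewrite ler_nat leq_mul2r num_dyn_classes_le_orbits // orbT.
Qed.
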